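(* Let $A$ be the cluster algebra over $\mathbb{C}$ defined by a $3\times 3$ skew-symmetric integer matrix (three mutable variables, no frozen variables). If $A$ does not satisfy the Louise property, then $A$ is not of finite type, i.e. not finitely generated as a $\mathbb{C}$-algebra. In particular, $\operatorname{Spec}A$ is not a 3-dimensional variety.
   Context: Extended exchange matrices: an $(n+m)\times n$ integer matrix $\widetilde{B}$ whose top $n\times n$ submatrix is skew-symmetric. A seed $(x,\widetilde{B})$ consists of $n+m$ algebraically independent variables $x_1,\dots,x_{n+m}$ and an extended exchange matrix; $x_1,\dots,x_n$ are mutable and $x_{n+1},\dots,x_{n+m}$ are frozen. With $[t]_+=\max(t,0)$, $[t]_-=\min(t,0)$, the mutation in direction $k\in\{1,\dots,n\}$ replaces $\widetilde{B}$ by $\widetilde{B}'$ with $\widetilde{B}'_{ij}=-\widetilde{B}_{ij}$ if $i=k$ or $j=k$, and $\widetilde{B}'_{ij}=\widetilde{B}_{ij}+[\widetilde{B}_{ik}]_+[\widetilde{B}_{kj}]_+-[\widetilde{B}_{ik}]_-[\widetilde{B}_{kj}]_-$ otherwise; it keeps $x_i$ for $i\ne k$ and replaces $x_k$ by $x_k'=\frac{1}{x_k}\left(\prod_j x_j^{[\widetilde{B}_{jk}]_+}+\prod_j x_j^{-[\widetilde{B}_{jk}]_-}\right)$. The cluster algebra defined by the seed is the $\mathbb{C}$-subalgebra of $\mathbb{C}(x_1,\dots,x_{n+m})$ generated by all mutable variables of all seeds obtained by iterated mutations, together with the frozen variables and their inverses. The seeds of $A$ are all seeds obtained from the initial one by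 iterated mutations. For a seed $t$, the mutable graph $\Gamma(t)_{mut}$ is the directed graph with vertices $1,\dots,n$ and an edge $i\to j$ of weight $\widetilde{B}_{ij}$ if and only if $\widetilde{B}_{ij}>0$. An edge $e:i\to j$ of $\Gamma(t)_{mut}$ is a separating edge if there is no bi-infinite directed path in $\Gamma(t)_{mut}$ through $e$. For a subset $S\subset\{1,\dots,n\}$ of mutable indices of a seed $t$, $A_S$ denotes the cluster algebra obtained from $t$ by freezing $S$, i.e. by regarding the variables $x_i$, $i\in S$, as frozen (deleting the corresponding columns of $\widetilde{B}$ and reordering rows so that frozen ones come last). Louise property (recursive definition): a cluster algebra $A$ satisfies the Louise property if either (1) for some seed $t$ of $A$ the graph $\Gamma(t)_{mut}$ has no edges, or (2) for some seed $t$ of $A$ the graph $\Gamma(t)_{mut}$ has a separating edge $i\to j$ such that the cluster algebras $A_{\{i\}}$, $A_{\{j\}}$ and $A_{\{i,j\}}$ all satisfy the Louise property. *)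

(* Defs.v *)
(* The complex numbers are R[i] for R : realType. *)
From HB Require Import structures.
From mathcomp Require Import all_boot all_order all_algebra.
From mathcomp Require Import fraction complex.
From mathcomp Require Import boolp classical_sets reals.
From mathcomp Require Import mpoly.

Set Implicit Arguments.
Unset Strict Implicit.
Unset Printing Implicit Defensive.

Import Order.TTheory GRing.Theory Num.Theory.
Local Open Scope ring_scope.
Local Open Scope classical_set_scope.

Definition pos_part (t : int) : int := Num.max t 0.
Definition neg_part (t : int) : int := Num.min t 0.

(* A seed with n mutable and m frozen variables lying in a field F.  Index
   [lshift m i] is the i-th mutable variable, [rshift n j] the j-th frozen one.
   Skew-symmetry of the top block and algebraic independence of the cluster are
   not fields of the record: they hold for the initial seed below and are
   preserved by mutation and by freezing. *)
Record seed (F : fieldType) (n m : nat) := Seed {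
  cluster : 'rV[F]_(n + m);
  exmat : 'M[int]_(n + m, n)
}.

Definition mutate_exmat (n m : nat) (B : 'M[int]_(n + m, n)) (k : 'I_n) :
    'M[int]_(n + m, n) :=
  let k' := lshift m k in
  \matrix_(i, j)
    if (i == k') || (j == k) then - B i j
    else B i j + pos_part (B i k) * pos_part (B k' j)
               - neg_part (B i k) * neg_part (B k' j).

Definition mutate_cluster (F : fieldType) (n m : nat) (x : 'rV[F]_(n + m))
    (B : 'M[int]_(n + m, n)) (k : 'I_n) : 'rV[F]_(n + m) :=
  let k' := lshift m k in
  \row_i
    if i == k' then
      (x 0 k')^-1 * (\prod_j x 0 j ^ pos_part (B j k)
                     + \prod_j x 0 j ^ (- neg_part (B j k)))
    else x 0 i.

Definition mutate (F : fieldType) (n m : nat) (s : seed F n m) (k : 'I_n) :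
    seed F n m :=
  Seed (mutate_cluster (cluster s) (exmat s) k) (mutate_exmat (exmat s) k).

(* [seed_of s t]: t is a seed of the cluster algebra defined by s. *)
Definition seed_of (F : fieldType) (n m : nat) (s t : seed F n m) : Prop :=
  exists ks : seq 'I_n, t = foldl (@mutate F n m) s ks.

Definition mutable_edge (F : fieldType) (n m : nat) (t : seed F n m) :
    rel 'I_n :=
  [rel i j | 0 < exmat t (lshift m i) j].

Definition bi_infinite_path (T : Type) (e : rel T) (p : int -> T) : Prop :=
  forall k : int, e (p k) (p (k + 1)).

Definition separating_edge (F : fieldType) (n m : nat) (t : seed F n m)
    (i j : 'I_n) : Prop :=
  mutable_edge t i j /\
  ~ exists p : int -> 'I_n, bi_infinite_path (mutable_edge t) p /\
      exists k : int, p k = i /\ p (k + 1) = j.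

(* Freezing S: the new rows are, in this order, the old mutable indices outside
   S, the indices in S, and the old frozen indices. *)
Definition freeze_index (n m : nat) (S : {set 'I_n})
    (r : 'I_(#|~: S| + (#|S| + m))) : 'I_(n + m) :=
  match split r with
  | inl a => lshift m (enum_val a)
  | inr r' =>
      match split r' with
      | inl b => lshift m (enum_val b)
      | inr c => rshift n c
      end
  end.

Definition freeze (F : fieldType) (n m : nat) (t : seed F n m)
    (S : {set 'I_n}) : seed F #|~: S| (#|S| + m) :=
  Seed (\row_r cluster t 0 (freeze_index r))
       (\matrix_(r, c) exmat t (freeze_index r) (enum_val c)).

(* A cluster algebra is referred to through a seed defining it. *)
Inductive Louise (F : fieldType) (n m : nat) (s : seed F n m) : Prop :=
| Louise_no_edges (t : seed F n m) :
    seed_of s t -> (forall i j : 'I_n, ~~ mutable_edge t i j) -> Louise s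
| Louise_separating (t : seed F n m) (i j : 'I_n) :
    seed_of s t -> separating_edge t i j ->
    Louise (freeze t [set i]%SET) ->
    Louise (freeze t [set j]%SET) ->
    Louise (freeze t [set i; j]%SET) ->
    Louise s.

(* Below, a field F is seen as a k-algebra through iota : k -> F (in use, a ring
   morphism), and k-subalgebras of F are given by their underlying sets. *)

Inductive subalg_gen (k F : fieldType) (iota : k -> F) (G : set F) : set F :=
| subalg_gen_scalar (c : k) : subalg_gen iota G (iota c)
| subalg_gen_gen (x : F) : G x -> subalg_gen iota G x
| subalg_gen_add (x y : F) :
    subalg_gen iota G x -> subalg_gen iota G y -> subalg_gen iota G (x + y)
| subalg_gen_mul (x y : F) :
    subalg_gen iota G x -> subalg_gen iota G y -> subalg_gen iota G (x * y).

Definition finitely_generated (k F : fieldType) (iota : k -> F) (A : set F) :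
    Prop :=
  exists gs : seq F, A = subalg_gen iota [set x | x \in gs].

Definition cluster_generators (F : fieldType) (n m : nat) (s : seed F n m) :
    set F :=
  [set x | (exists t : seed F n m, seed_of s t /\
             exists i : 'I_n, x = cluster t 0 (lshift m i))
        \/ (exists j : 'I_m, x = cluster s 0 (rshift n j))
        \/ (exists j : 'I_m, x = (cluster s 0 (rshift n j))^-1)].

Definition cluster_algebra (k F : fieldType) (iota : k -> F) (n m : nat)
    (s : seed F n m) : set F :=
  subalg_gen iota (cluster_generators s).

(* Points of Spec A, for a subring A of F. *)
Definition prime_ideal (F : fieldType) (A P : set F) : Prop :=
  [/\ P `<=` A,
      P 0,
      forall x y, P x -> P y -> P (x + y),
      forall a x, A a -> P x -> P (a * x)
    & ~ P 1 /\ forall x y, A x -> A y -> P (x * y) -> P x \/ P y].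

Definition prime_chain (F : fieldType) (A : set F) (d : nat) : Prop :=
  exists P : nat -> set F,
    (forall i, (i <= d)%N -> prime_ideal A (P i)) /\
    (forall i, (i < d)%N -> P i `<` P i.+1).

(* Irreducible closed subsets of Spec A correspond to prime ideals of A. *)
Definition Spec_dim (F : fieldType) (A : set F) (d : nat) : Prop :=
  prime_chain A d /\ ~ prime_chain A d.+1.

Definition localization (F : fieldType) (A : set F) (f : F) : set F :=
  [set z | exists a : F, exists e : nat, A a /\ z = a / f ^+ e].

(* Spec A -> Spec k is of finite type: Spec A is a finite union of basic affine
   opens D(f) whose coordinate rings A_f are finitely generated k-algebras.
   (D(0) is empty, so f != 0 is no restriction.) *)
Definition Spec_finite_type (k F : fieldType) (iota : k -> F) (A : set F) :
    Prop :=
  exists fs : seq F,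
    [/\ forall f, f \in fs -> A f /\ f != 0,
        forall P, prime_ideal A P -> exists2 f, f \in fs & ~ P f
      & forall f, f \in fs -> finitely_generated iota (localization A f)].

(* A variety is an integral separated scheme of finite type over k.  As A is a
   subring of a field, Spec A is integral, and it is separated since affine. *)
Definition Spec_variety (k F : fieldType) (iota : k -> F) (A : set F)
    (d : nat) : Prop :=
  Spec_finite_type iota A /\ Spec_dim A d.

Definition rational_functions (k : fieldType) (N : nat) : fieldType :=
  {fraction {mpoly k[N]}}.

Definition ratfun_const (k : fieldType) (N : nat) (c : k) :
    rational_functions k N :=
  tofrac (c%:MP : {mpoly k[N]}).

Definition ratfun_var (k : fieldType) (N : nat) (i : 'I_N) :
    rational_functions k N :=
  tofrac ('X_i : {mpoly k[N]}).

Definition initial_seed (k : fieldType) (n m : nat)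
    (B : 'M[int]_(n + m, n)) : seed (rational_functions k (n + m)) n m :=
  Seed (\row_i ratfun_var k i) B.

(* Main.v *)
Require Import Defs.
From mathcomp Require Import all_boot all_order all_algebra.
From mathcomp Require Import fraction complex.
From mathcomp Require Import boolp classical_sets reals.
From mathcomp Require Import mpoly.
From mathcomp Require Import zify ring.
Set Implicit Arguments.
Unset Strict Implicit.
Unset Printing Implicit Defensive.

Import Order.TTheory GRing.Theory Num.Theory.
Local Open Scope ring_scope.

(** The exchange matrix of a seed that is not Louise contains a directed
    3-cycle, and so does that of each of its mutations: an acyclic seed is
    Louise, since all of its edges are separating and freezing keeps it acyclic.
    Write [d k] for the weight of the edge opposite to [k] in the 3-cycle.  The
    exchange relation at [k] is then
      [x_k x_k' = x_(k+1)^(d (k-1)) + x_(k-1)^(d (k+1))],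
    so that giving [x_i] the degree [d i] makes both sides homogeneous, and the
    mutated seed has degree [d (k+1) * d (k-1) - d k] at [k].  As the mutated
    seed is cyclic too, this is positive: all cluster variables have positive
    degree, while no relation has a constant term.

    On the other hand let [x_i] have the tropical exponent [u i], so that [x_k']
    has exponent [min (d (k-1) * u (k+1)) (d (k+1) * u (k-1)) - u k].  In terms
    of the ratios [rho = u / d] this says that [min (rho (k+1)) (rho (k-1))] is
    the average of [rho k] and [rho k'] with weights [d k] and [d' k]
    ([ratio_mutate]).  Hence, if the ratios in a seed are not all equal, mutating
    at the largest one produces a ratio smaller than all three
    ([ratio_mutate_lt]), and the ratios of the new seed are again not all equal
    ([nonconstant_mutate]).  The infimum of [rho] over all cluster variables is
    therefore never attained ([cluster_ratio_descent]).

    For a rational [lam], the difference [u - lam * d] is again a tropical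
    exponent.  Up to clearing the denominator of [lam], it is the order of
    vanishing of the cluster variables along the real curve
    [x_i = tau^(u0 i - lam * d0 i)], [tau -> 0]; since cluster variables are
    subtraction-free, no cancellation can spoil this.  So a cluster variable
    tends to 0 if [lam < rho] and is unbounded if [rho < lam].  An element of
    [A] is a polynomial in finitely many cluster variables, so for all [lam]
    below some attained ratio it tends to its constant term
    ([cluster_algebra_value]).  The elements whose constant term vanishes form a
    prime ideal, the origin of [Spec A].  If [f] does not vanish there and [A_f]
    is finitely generated, then for all [lam] below some attained ratio [f] is a
    unit among the bounded elements, so that the finitely many generators of
    [A_f], hence all elements of [A], are bounded.  But two steps of the descent
    give [lam] in this range and a cluster variable of ratio smaller than [lam],
    which is unbounded.  Thus [Spec A] is not of finite type at its origin; the
    case [f = 1] says that [A] is not finitely generated. *)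

(** * Acyclic seeds have the Louise property *)

Section Acyclic.
Context {F : fieldType}.

Definition skew_symmetric n m (t : seed F n m) :=
  forall i j, exmat t (lshift m i) j = - exmat t (lshift m j) i.

Lemma freeze_edge n m (t : seed F n m) (S : {set 'I_n}) i j :
  mutable_edge (freeze t S) i j = mutable_edge t (enum_val i) (enum_val j).
Proof. by rewrite /mutable_edge /= mxE /freeze_index (unsplitK (inl i)). Qed.

Lemma skew_symmetric_freeze n m (t : seed F n m) (S : {set 'I_n}) :
  skew_symmetric t -> skew_symmetric (freeze t S).
Proof.
by move=> skt i j; rewrite !mxE /freeze_index (unsplitK (inl i)) (unsplitK (inl j)).
Qed.

Lemma seed_of_refl n m (t : seed F n m) : seed_of t t.
Proof. by exists [::]. Qed.

Lemma seed_of_trans n m (s t r : seed F n m) :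
  seed_of s t -> seed_of t r -> seed_of s r.
Proof. by move=> [ks ->] [ls ->]; exists (ks ++ ls); rewrite foldl_cat. Qed.

Lemma seed_of_mutate n m (s t : seed F n m) k :
  seed_of s t -> seed_of s (mutate t k).
Proof. by move=> st; apply: seed_of_trans st _; exists [:: k]. Qed.

Lemma Louise_seed_of n m (s t : seed F n m) :
  seed_of s t -> Louise t -> Louise s.
Proof.
move=> st [r tr noedge | r i j tr].
  exact: Louise_no_edges (seed_of_trans st tr) noedge.
exact: Louise_separating (seed_of_trans st tr).
Qed.

(** Every edge is separating for lack of any bi-infinite path at all, and a path
    in a frozen seed is one in the original seed, so induction on the number of
    mutable variables applies to the three frozen seeds. *)
Lemma acyclic_Louise n m (t : seed F n m) :
  skew_symmetric t -> ~ (exists p, bi_infinite_path (mutable_edge t) p) ->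
  Louise t.
Proof.
elim/ltn_ind: n m t => n IHn m t skt acyc.
have [[i [j ij]] | noedge] := pselect (exists i j, mutable_edge t i j); last first.
  apply: (Louise_no_edges (seed_of_refl t)) => i j.
  by apply/negP => ij; apply: noedge; exists i, j.
have frozen (S : {set 'I_n}) l : l \in S -> Louise (freeze t S).
  move=> Sl; apply: IHn; [|exact: skew_symmetric_freeze|].
    rewrite -[X in (_ < X)%N](card_ord n) -cardsT.
    apply/proper_card/properP; split; first exact: finset.subsetT.
    by exists l; rewrite ?inE // Sl.
  move=> [p path_p]; apply: acyc; exists (fun k => enum_val (p k)) => k.
  by rewrite -freeze_edge.
apply: (Louise_separating (seed_of_refl t) (i := i) (j := j)).
- by split=> // -[p [path_p _]]; apply: acyc; exists p.
- by apply: (frozen _ i); rewrite inE.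
- by apply: (frozen _ j); rewrite inE.
- by apply: (frozen _ i); rewrite !inE eqxx.
Qed.

Lemma skew_symmetric_mutate n m (t : seed F n m) k :
  skew_symmetric t -> skew_symmetric (mutate t k).
Proof.
move=> skt i j; rewrite !mxE !(inj_eq (@lshift_inj _ _)) orbC.
case: ifP => _; first by rewrite skt.
rewrite [exmat t (lshift m i) j]skt [exmat t (lshift m i) k]skt.
rewrite [exmat t (lshift m j) k]skt /pos_part /neg_part.
have mx a : Num.max (- a) 0 = - Num.min a 0 :> int by rewrite oppr_min oppr0.
have mn a : Num.min (- a) 0 = - Num.max a 0 :> int by rewrite oppr_max oppr0.
rewrite !(mx, mn); ring.
Qed.

Lemma skew_symmetric_seed_of n m (s t : seed F n m) :
  seed_of s t -> skew_symmetric s -> skew_symmetric t.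
Proof.
move=> [ks ->]; elim: ks s => [|k ks IHks] s sks //=.
exact/IHks/skew_symmetric_mutate.
Qed.

End Acyclic.

(** * Mutation-cyclic seeds of rank 3 *)

Lemma I3_cases (k i : 'I_3) : [\/ i = k, i = k + 1 | i = k - 1].
Proof.
by case: k i => [[|[|[|//]]] ?] [[|[|[|//]]] ?];
   first [ constructor 1; apply: val_inj; reflexivity
         | constructor 2; apply: val_inj; reflexivity
         | constructor 3; apply: val_inj; reflexivity ].
Qed.

Lemma I3_addr2 (k : 'I_3) : k + 1 + 1 = k - 1.
Proof. by case: k => [[|[|[|//]]] ?]; apply: val_inj. Qed.

Lemma I3_subr2 (k : 'I_3) : k - 1 - 1 = k + 1.
Proof. by case: k => [[|[|[|//]]] ?]; apply: val_inj. Qed.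

Lemma I3_neq (k : 'I_3) :
  ((k + 1 == k) = false) * ((k - 1 == k) = false) * ((k + 1 == k - 1) = false)
  * ((k - 1 == k + 1) = false).
Proof. by case: k => [[|[|[|//]]] ?]. Qed.

Section Rank3.
Context {F : fieldType}.
Implicit Types (t : seed F 3 0) (d u : 'I_3 -> int).

(** The sign [e] is the orientation of the 3-cycle.  The number [d i] is attached
    to the vertex opposite to the edge because it serves as the degree of the
    [i]-th cluster variable: [d] spans the kernel of the exchange matrix. *)
Definition cyclic_seed t (e : int) d :=
  [/\ e = 1 \/ e = -1, forall i, 0 < d i
    & forall i, exmat t (lshift 0 i) (i + 1) = e * d (i - 1)].

(** Three consecutive steps of the path suffice: as there are neither loops nor
    2-cycles, its first three vertices are distinct and the fourth is the
    first. *)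
Lemma bi_infinite_path_cyclic t p :
  skew_symmetric t -> bi_infinite_path (mutable_edge t) p ->
  exists e d, cyclic_seed t e d.
Proof.
move=> skt path_p; set M := fun i j => exmat t (lshift 0 i) j.
have sk i j : M i j = - M j i by exact: skt.
have loop i : ~ 0 < M i i by have := sk i i; lia.
have back i j : 0 < M i j -> ~ 0 < M j i by rewrite (sk j i); lia.
have edge k : 0 < M (p k) (p (k + 1)) by exact: path_p.
have [ab bc ca] : [/\ 0 < M (p 0) (p 1), 0 < M (p 1) (p 2) & 0 < M (p 2) (p 3)].
  by split; [exact: (edge 0) | exact: (edge 1) | exact: (edge 2)].
move: (p 0) (p 1) (p 2) (p 3) ab bc ca => a b c a' ab bc ca.
have noloop i j : i = j -> ~ 0 < M i j by move=> ->; exact: loop.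
case: (I3_cases a b) => [ba|ba|ba]; first by case: (noloop _ _ (esym ba)).
  case: (I3_cases a c) => [ca'|cb|ca'].
  - by case: (back _ _ ab); move: bc; rewrite ca'.
  - by case: (noloop b c) => //; rewrite ba cb.
  case: (I3_cases a a') => [aa|aa|aa].
  - exists 1, (fun i => M (i + 1) (i - 1)); split; [by left| |]=> i.
      rewrite aa ba ca' in ab bc ca.
      by case: (I3_cases a i) => ->; rewrite ?I3_addr2 ?I3_subr2 ?addrK ?subrK.
    by rewrite mul1r subrK I3_subr2.
  - by case: (back _ _ bc); move: ca; rewrite ba -aa.
  - by case: (noloop c a') => //; rewrite aa ca'.
case: (I3_cases a c) => [ca'|cb|cb].
- by case: (back _ _ ab); move: bc; rewrite ca'.
- case: (I3_cases a a') => [aa|aa|aa].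
  + exists (-1), (fun i => M (i - 1) (i + 1)); split; [by right| |]=> i.
      rewrite aa ba cb in ab bc ca.
      by case: (I3_cases a i) => ->; rewrite ?I3_addr2 ?I3_subr2 ?addrK ?subrK.
    by rewrite subrK I3_subr2 mulN1r; exact: skt.
  + by case: (noloop c a') => //; rewrite aa cb.
  + by case: (back _ _ bc); move: ca; rewrite ba -aa.
- by case: (noloop b c) => //; rewrite ba cb.
Qed.

Definition update (x : 'I_3 -> int) (k : 'I_3) (y : int) : 'I_3 -> int :=
  fun i => if i == k then y else x i.

Definition mutate_degree d k : 'I_3 -> int :=
  update d k (d (k + 1) * d (k - 1) - d k).

(** That the mutated seed is cyclic is a hypothesis, not a consequence: it forces
    [d (k + 1) * d (k - 1) - d k] to be positive. *)
Lemma cyclic_seed_mutate t e d k e' d' :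
  skew_symmetric t -> cyclic_seed t e d -> cyclic_seed (mutate t k) e' d' ->
  e' = - e /\ d' =1 mutate_degree d k.
Proof.
move=> skt [he dgt0 Md] [he' d'gt0 Md'].
have dk := dgt0 k; have dp := dgt0 (k + 1); have dm := dgt0 (k - 1).
have := (Md k, Md (k + 1), Md (k - 1)).
have := (Md' k, Md' (k + 1), Md' (k - 1)).
rewrite !mxE !(inj_eq (@lshift_inj _ _)) !I3_addr2 !I3_subr2 !addrK !subrK.
rewrite !eqxx !I3_neq /= [exmat t (lshift 0 (k + 1)) k]skt.
rewrite [exmat t (lshift 0 k) (k - 1)]skt.
move=> [[E1 E2] E3] [[E4 E5] E6].
rewrite E4 E5 E6 in E1 E2 E3.
have d'k := d'gt0 k; have d'p := d'gt0 (k + 1); have d'm := d'gt0 (k - 1).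
have ee : e' = - e by case: he he' E1 => -> [] ->; nia.
split=> // i; rewrite /mutate_degree /update.
rewrite ee in E1 E2 E3; rewrite /pos_part /neg_part in E2.
case: (I3_cases k i) => ->; rewrite ?eqxx ?I3_neq;
  by case: he E1 E2 E3 => ->; rewrite ?mul1r ?mulN1r ?opprK; lia.
Qed.

Lemma cyclic_seed_exchange t e d k :
  skew_symmetric t -> cyclic_seed t e d ->
  let x i := cluster t 0 (lshift 0 i) in
  cluster (mutate t k) 0 (lshift 0 k) =
    (x k)^-1 * (x (k + 1) ^ d (k - 1) + x (k - 1) ^ d (k + 1)).
Proof.
move=> skt [he dgt0 Md] /=.
rewrite mxE eqxx; congr (_ * _).
have E1 := Md k; have E2 := Md (k - 1); rewrite subrK I3_subr2 in E2.
have E0 : exmat t (lshift 0 k) k = 0 by have := skt k k; lia.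
have big (G : 'I_(3 + 0) -> F) :
    \prod_i G i = G (lshift 0 k) * G (lshift 0 (k + 1)) * G (lshift 0 (k - 1)).
  rewrite big_split_ord /= big_ord0 mulr1 (bigD1 k) //= (bigD1 (k + 1)) ?I3_neq //=.
  rewrite (bigD1 (k - 1)) ?I3_neq //= big1 ?mulr1 ?mulrA // => i.
  by case: (I3_cases k i) => ->; rewrite ?eqxx ?andbF.
have parts a : 0 < a -> [/\ pos_part a = a, neg_part a = 0,
    pos_part (- a) = 0 & neg_part (- a) = - a].
  by rewrite /pos_part /neg_part => ?; split; lia.
have [pos0 neg0] : pos_part 0 = 0 /\ neg_part 0 = 0 by [].
have [p1 n1 p1' n1'] := parts _ (dgt0 (k + 1)).
have [p2 n2 p2' n2'] := parts _ (dgt0 (k - 1)).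
rewrite !big E0 [exmat t (lshift 0 (k + 1)) k]skt E1 E2 pos0 neg0.
by case: he => ->; rewrite ?(mul1r, mulN1r, opprK) ?(p1, n1, p1', n1', p2, n2, p2', n2')
  ?(oppr0, expr0z, opprK) ?(mul1r, mulr1) // addrC.
Qed.

End Rank3.

(** * Asymptotics along a monomial curve *)

Lemma ratfun_constD (k : fieldType) N (c c' : k) :
  ratfun_const N (c + c') = ratfun_const N c + ratfun_const N c'.
Proof. by rewrite /ratfun_const mpolyCD tofracD. Qed.

Lemma ratfun_constM (k : fieldType) N (c c' : k) :
  ratfun_const N (c * c') = ratfun_const N c * ratfun_const N c'.
Proof. by rewrite /ratfun_const mpolyCM tofracM. Qed.

Lemma ratfun_const0 (k : fieldType) N : ratfun_const N (0 : k) = 0.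
Proof. by rewrite /ratfun_const mpolyC0 tofrac0. Qed.

Lemma ratfun_const1 (k : fieldType) N : ratfun_const N (1 : k) = 1.
Proof. by rewrite /ratfun_const mpolyC1 tofrac1. Qed.

Definition eventually (Q : nat -> Prop) : Prop :=
  exists M : nat, forall m, (M <= m)%N -> Q m.

Lemma eventually_and (P Q : nat -> Prop) :
  eventually P -> eventually Q -> eventually (fun m => P m /\ Q m).
Proof.
move=> [M PM] [N QN]; exists (maxn M N) => m.
by rewrite geq_max => /andP[/PM ? /QN].
Qed.

Lemma eventually_mono (P Q : nat -> Prop) :
  (forall m, P m -> Q m) -> eventually P -> eventually Q.
Proof. by move=> PQ [M PM]; exists M => m /PM/PQ. Qed.

Lemma eventually_exists (P : nat -> Prop) : eventually P -> exists m, P m.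
Proof. by move=> [M PM]; exists M; exact: PM. Qed.

Section Germs.
Context {K : fieldType} {N : nat} (pt : nat -> 'I_N -> K).
Implicit Types (f g : rational_functions K N) (phi psi : nat -> K).

(** A rational function has no values at its poles, so [f] is represented by any
    function [phi] that agrees with it at [pt m] for all large [m]. *)
Definition germ f phi : Prop :=
  exists P Q : {mpoly K[N]}, f = tofrac P / tofrac Q /\
    eventually (fun m => Q.@[pt m] != 0 /\ phi m = P.@[pt m] / Q.@[pt m]).

Lemma meval_neq0 (v : 'I_N -> K) (Q : {mpoly K[N]}) :
  Q.@[v] != 0 -> tofrac Q != 0.
Proof. by rewrite tofrac_eq0; apply: contraNneq => ->; rewrite meval0. Qed.

Lemma germ_unique f phi psi :
  germ f phi -> germ f psi -> eventually (fun m => phi m = psi m).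
Proof.
move=> [P [Q [-> ev]]] [P' [Q' [E ev']]].
apply: eventually_mono (eventually_and ev ev') => m [[Qm ->] [Q'm ->]].
have Q0 := meval_neq0 Qm; have Q'0 := meval_neq0 Q'm.
apply/eqP; rewrite eqr_div //; apply/eqP.
move/eqP: E; rewrite (eqr_div _ _ Q0 Q'0).
rewrite -(tofracM P Q').
rewrite -(tofracM P' Q).
rewrite tofrac_eq => /eqP E.
by rewrite -!mevalM E.
Qed.

Lemma germ_poly (P : {mpoly K[N]}) : germ (tofrac P) (fun m => P.@[pt m]).
Proof.
exists P, 1; rewrite tofrac1 divr1; split=> //; exists 0%N => m _.
by rewrite meval1 divr1 oner_neq0.
Qed.

Lemma germ_const c : germ (ratfun_const N c) (fun=> c).
Proof.
have [P [Q [E ev]]] := germ_poly c%:MP.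
by exists P, Q; split=> //; apply: eventually_mono ev => m; rewrite mevalC.
Qed.

Lemma germ_var i : germ (ratfun_var K i) (fun m => pt m i).
Proof.
have [P [Q [E ev]]] := germ_poly 'X_i.
by exists P, Q; split=> //; apply: eventually_mono ev => m; rewrite mevalXU.
Qed.

Lemma germD f g phi psi :
  germ f phi -> germ g psi -> germ (f + g) (fun m => phi m + psi m).
Proof.
move=> [P [Q [-> ev]]] [P' [Q' [-> ev']]].
have {ev'}ev := eventually_and ev ev'.
have [m0 [[Qm0 _] [Q'm0 _]]] := eventually_exists ev.
have Q0 := meval_neq0 Qm0; have Q'0 := meval_neq0 Q'm0.
exists (P * Q' + P' * Q), (Q * Q'); split.
  rewrite (addf_div _ _ Q0 Q'0) (tofracD (P * Q')).
  by rewrite (tofracM P) (tofracM P') (tofracM Q).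
apply: eventually_mono ev => m [[Qm ->] [Q'm ->]].
by rewrite mevalD !mevalM mulf_neq0 // addf_div.
Qed.

Lemma germM f g phi psi :
  germ f phi -> germ g psi -> germ (f * g) (fun m => phi m * psi m).
Proof.
move=> [P [Q [-> ev]]] [P' [Q' [-> ev']]].
exists (P * P'), (Q * Q'); split; first by rewrite mulf_div (tofracM P) (tofracM Q).
apply: eventually_mono (eventually_and ev ev') => m [[Qm ->] [Q'm ->]].
by rewrite !mevalM mulf_neq0 // mulf_div.
Qed.

Lemma germV f phi :
  germ f phi -> eventually (fun m => phi m != 0) ->
  germ f^-1 (fun m => (phi m)^-1).
Proof.
move=> [P [Q [-> ev]]] phi0; exists Q, P; rewrite invf_div; split=> //.
apply: eventually_mono (eventually_and ev phi0) => m [[Qm ->]].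
by rewrite invf_div mulf_eq0 negb_or => /andP[].
Qed.

End Germs.

Lemma complex_archimedean (R : realType) (x : R[i]) :
  exists m : nat, `|x| < 2 ^+ m.
Proof.
have xr : `|x| \is Num.real by exact: normr_real.
have /complex_realP[r rE] : `|x| \is Num.real by [].
have [m rm] : exists m : nat, r < m%:R.
  by exists (Num.bound `|r|); apply: le_lt_trans (ler_norm r) (archi_boundP _).
exists m; rewrite rE; apply: (@lt_trans _ _ m%:R).
  by rewrite -[m%:R](rmorph_nat (real_complex R)) ltcR.
by rewrite -natrX ltr_nat ltn_expl.
Qed.

Section Orders.
Context {R : realType} {N : nat} (w : 'I_N -> int).
Let K : numClosedFieldType := R[i].
Implicit Types (f g : rational_functions K N).

Let tau (m : nat) : K := 2^-1 ^+ m.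

Let tau_gt0 m : 0 < tau m.
Proof. by rewrite exprn_gt0 // invr_gt0. Qed.

Let tau_neq0 m : tau m != 0.
Proof. by rewrite gt_eqF. Qed.

Let tau_le1 m : tau m <= 1.
Proof. by rewrite exprn_ile1 ?invr_ge0 ?invf_le1 ?ler1n. Qed.

Let tau_small (x : K) : 0 < x -> eventually (fun m => tau m < x).
Proof.
move=> x0; have [M xM] := complex_archimedean x^-1.
exists M => m Mm; rewrite /tau exprVn invf_plt ?posrE ?exprn_gt0 //.
rewrite -[x^-1]ger0_norm ?invr_ge0 1?ltW //; apply: lt_le_trans xM _.
by rewrite ler_weXn2l ?ler1n.
Qed.

Let tauz_gt0 m (e : int) : 0 < tau m ^ e.
Proof. exact: exprz_gt0. Qed.

Let tauz_anti m (e e' : int) : e <= e' -> tau m ^ e' <= tau m ^ e.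
Proof.
rewrite -subr_ge0 => h; rewrite -[e'](subrK e) expfzDr //.
rewrite ler_piMl ?(ltW (tauz_gt0 m e)) //; case: (e' - e) h => // n _.
exact: exprn_ile1 (ltW (tau_gt0 m)) (tau_le1 m).
Qed.

(** Points of the curve [x_i = t^(w i)], taken at [t = 2^-m]. *)
Definition pt (m : nat) (i : 'I_N) : K := tau m ^ w i.

(** The two-sided estimate is positive, which is what allows division and rules
    out cancellation in sums: on such functions the order behaves tropically. *)
Definition has_order f (e : int) : Prop :=
  exists2 phi, germ pt f phi &
  exists c C : K, [/\ 0 < c, 0 < C &
    eventually (fun m => c * tau m ^ e <= phi m <= C * tau m ^ e)].

Definition bounded f : Prop :=
  exists2 phi, germ pt f phi & exists C : K, eventually (fun m => `|phi m| <= C).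

(** Integer exponents make [O(t)] the right notion of tending to 0. *)
Definition small f : Prop :=
  exists2 phi, germ pt f phi &
  exists C : K, eventually (fun m => `|phi m| <= C * tau m).

Lemma has_order_var i : has_order (ratfun_var K i) (w i).
Proof.
exists (fun m => pt m i); first exact: germ_var.
by exists 1, 1; split=> //; exists 0%N => m _; rewrite mul1r lexx.
Qed.

Lemma has_order1 : has_order 1 0.
Proof.
exists (fun=> 1).
  by rewrite -(ratfun_const1 K N); exact: germ_const.
by exists 1, 1; split=> //; exists 0%N => m _; rewrite expr0z mul1r lexx.
Qed.

Lemma has_orderM f g e e' :
  has_order f e -> has_order g e' -> has_order (f * g) (e + e').
Proof.
move=> [phi fphi [c [C [c0 C0 ev]]]] [psi gpsi [c' [C' [c'0 C'0 ev']]]].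
exists (fun m => phi m * psi m); first exact: germM.
exists (c * c'), (C * C'); split; try exact: mulr_gt0.
apply: eventually_mono (eventually_and ev ev') => m [/andP[l u] /andP[l' u']].
have p0 := ltW (mulr_gt0 c0 (tauz_gt0 m e)).
have p0' := ltW (mulr_gt0 c'0 (tauz_gt0 m e')).
rewrite expfzDr // !(mulrACA _ _ (tau m ^ e)) !ler_pM //.
  exact: le_trans l.
exact: le_trans l'.
Qed.

Lemma has_orderV f e : has_order f e -> has_order f^-1 (- e).
Proof.
move=> [phi fphi [c [C [c0 C0 ev]]]].
have pos : eventually (fun m => 0 < phi m).
  apply: eventually_mono ev => m /andP[l _].
  by apply: lt_le_trans l; rewrite mulr_gt0.
exists (fun m => (phi m)^-1).
  by apply: germV => //; apply: eventually_mono pos => m /gt_eqF ->.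
exists C^-1, c^-1; split; rewrite ?invr_gt0 //.
apply: eventually_mono (eventually_and ev pos) => m [/andP[l u] phi0].
rewrite -invr_expz -!invfM !lef_pV2 ?posrE ?mulr_gt0 //.
by rewrite u l.
Qed.

Lemma has_orderX f e (n : int) : 0 <= n -> has_order f e -> has_order (f ^ n) (n * e).
Proof.
case: n => // n _ fe; elim: n => [|n IHn].
  by rewrite expr0z mul0r; exact: has_order1.
rewrite exprSz -(addn1 n) PoszD mulrDl mul1r addrC.
exact: has_orderM.
Qed.

(** By positivity the sum is at least its dominant term. *)
Lemma has_orderD f g e e' :
  has_order f e -> has_order g e' -> has_order (f + g) (Num.min e e').
Proof.
wlog ee' : f g e e' / e <= e' => [hw fe ge'|].
  have [ee'|/ltW ee'] := leP e e'.
    by have := hw _ _ _ _ ee' fe ge'; rewrite min_l.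
  by have := hw _ _ _ _ ee' ge' fe; rewrite min_l // addrC.
rewrite min_l // => -[phi fphi [c [C [c0 C0 ev]]]] [psi gpsi [c' [C' [c'0 C'0 ev']]]].
exists (fun m => phi m + psi m); first exact: germD.
exists c, (C + C'); split=> //; first exact: addr_gt0.
apply: eventually_mono (eventually_and ev ev') => m [/andP[l u] /andP[l' u']].
apply/andP; split.
  apply: le_trans l _; rewrite lerDl.
  by apply: le_trans l'; rewrite mulr_ge0 ?ltW.
rewrite mulrDl lerD //; apply: le_trans u' _.
by rewrite ler_pM2l // tauz_anti.
Qed.

Lemma bounded_const c : bounded (ratfun_const N c).
Proof.
exists (fun=> c); first exact: germ_const.
by exists `|c|, 0%N.
Qed.

Lemma boundedD f g : bounded f -> bounded g -> bounded (f + g).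
Proof.
move=> [phi fphi [C ev]] [psi gpsi [C' ev']].
exists (fun m => phi m + psi m); first exact: germD.
exists (C + C'); apply: eventually_mono (eventually_and ev ev') => m [u u'].
by apply: le_trans (ler_normD _ _) _; exact: lerD.
Qed.

Lemma boundedM f g : bounded f -> bounded g -> bounded (f * g).
Proof.
move=> [phi fphi [C ev]] [psi gpsi [C' ev']].
exists (fun m => phi m * psi m); first exact: germM.
exists (C * C'); apply: eventually_mono (eventually_and ev ev') => m [u u'].
by rewrite normrM ler_pM.
Qed.

Lemma smallD f g : small f -> small g -> small (f + g).
Proof.
move=> [phi fphi [C ev]] [psi gpsi [C' ev']].
exists (fun m => phi m + psi m); first exact: germD.
exists (C + C'); apply: eventually_mono (eventually_and ev ev') => m [u u'].
by apply: le_trans (ler_normD _ _) _; rewrite mulrDl lerD.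
Qed.

Lemma bounded_smallM f g : bounded f -> small g -> small (f * g).
Proof.
move=> [phi fphi [C ev]] [psi gpsi [C' ev']].
exists (fun m => phi m * psi m); first exact: germM.
exists (C * C'); apply: eventually_mono (eventually_and ev ev') => m [u u'].
by rewrite normrM -mulrA ler_pM.
Qed.

Lemma small_bounded f : small f -> bounded f.
Proof.
move=> [phi fphi [C ev]]; exists phi => //; exists C.
apply: eventually_mono ev => m u.
have C0 : 0 <= C.
  by rewrite -(pmulr_lge0 _ (tau_gt0 m)); apply: (le_trans _ u).
by apply: (le_trans u); rewrite ler_piMr.
Qed.

Lemma small0 : small 0.
Proof.
exists (fun=> 0).
  by rewrite -(ratfun_const0 K N); exact: germ_const.
by exists 0, 0%N => m _; rewrite normr0 mul0r.
Qed.

Lemma small_const_eq0 c : small (ratfun_const N c) -> c = 0.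
Proof.
move=> [phi cphi [C ev]].
have E := germ_unique (germ_const pt c) cphi.
apply/eqP; apply: contraT => c0.
have C1 : 0 < `|C| + 1 by rewrite ltr_wpDl.
have ct : 0 < `|c| / (`|C| + 1) by rewrite divr_gt0 ?normr_gt0.
have [m [[u E'] t]] := eventually_exists
  (eventually_and (eventually_and ev E) (tau_small ct)).
rewrite -E' in u.
have C0 : 0 <= C by rewrite -(pmulr_lge0 _ (tau_gt0 m)); apply: (le_trans _ u).
move: t; rewrite ltr_pdivlMr // ger0_norm // mulrDr mulr1 mulrC => t.
have := lt_le_trans t u; rewrite gtrDl.
by rewrite lt_gtF.
Qed.

(** Elements with nonzero limit are units among the bounded ones. *)
Lemma bounded_inv f c :
  c != 0 -> small (f - ratfun_const N c) -> bounded f^-1.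
Proof.
move=> c0 [psi fpsi [C ev]].
pose phi m := psi m + c.
have fphi : germ pt f phi.
  by rewrite -(subrK (ratfun_const N c) f); apply: germD => //; exact: germ_const.
have c2 : 0 < `|c| / 2 by rewrite divr_gt0 ?normr_gt0.
have C1 : 0 < `|C| + 1 by rewrite ltr_wpDl.
have ct : 0 < `|c| / 2 / (`|C| + 1) by rewrite divr_gt0.
have low : eventually (fun m => `|c| / 2 <= `|phi m|).
  apply: eventually_mono (eventually_and ev (tau_small ct)) => m [v t].
  have C0 : 0 <= C.
    by rewrite -(pmulr_lge0 _ (tau_gt0 m)); apply: (le_trans _ v).
  move: t; rewrite ltr_pdivlMr // ger0_norm // mulrDr mulr1 mulrC => t.
  have psi_le : `|psi m| <= `|c| / 2.
    apply: le_trans v _; apply: le_trans (ltW t); by rewrite lerDl ltW.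
  have : `|c| <= `|phi m| + `|psi m|.
    have -> : c = phi m - psi m by rewrite /phi addrAC subrr add0r.
    exact: ler_normB.
  rewrite -lerBlDr; apply: le_trans.
  by rewrite [X in _ <= X - _](splitr `|c|) lerBrDr lerD2l.
exists (fun m => (phi m)^-1).
  apply: germV => //; apply: eventually_mono low => m l.
  by rewrite -normr_gt0; apply: lt_le_trans l.
exists (`|c| / 2)^-1; apply: eventually_mono low => m l.
by rewrite normfV lef_pV2 ?posrE //; apply: lt_le_trans l.
Qed.

Lemma has_order_small f e : 0 < e -> has_order f e -> small f.
Proof.
move=> e0 [phi fphi [c [C [c0 C0 ev]]]]; exists phi => //; exists C.
apply: eventually_mono ev => m /andP[l u].
have p0 := mulr_gt0 c0 (tauz_gt0 m e).
rewrite ger0_norm; last exact: le_trans (ltW p0) l.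
by apply: le_trans u _; rewrite ler_pM2l // -{2}[tau m]expr1z tauz_anti.
Qed.

Lemma has_order_unbounded f e : e < 0 -> has_order f e -> ~ bounded f.
Proof.
move=> e0 [phi fphi [c [C [c0 C0 ev]]]] [psi fpsi [D ev']].
have E := germ_unique fphi fpsi.
have D1 : 0 < `|D| + 1 by rewrite ltr_wpDl.
have ct : 0 < c / (`|D| + 1) by rewrite divr_gt0.
have [m [[[/andP[l _] u] E'] t]] := eventually_exists
  (eventually_and (eventually_and (eventually_and ev ev') E) (tau_small ct)).
have D0 : 0 <= D by apply: (le_trans _ u).
have {}l : c * tau m ^ (-1) <= D.
  apply: (le_trans _ u); rewrite -E' ger0_norm; last first.
    by apply: (le_trans _ l); rewrite mulr_ge0 ?ltW.
  by apply: (le_trans _ l); rewrite ler_pM2l // tauz_anti //; lia.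
move: t; rewrite ltr_pdivlMr // ger0_norm // mulrDr mulr1 mulrC => t.
rewrite exprN1 ler_pdivrMr // in l.
by have := lt_le_trans t l; rewrite gtrDl lt_gtF.
Qed.

End Orders.

(** * Tropical exponents and their ratios to the degrees *)

Section Tropical.
Implicit Types (d u : 'I_3 -> int) (lam : rat).

Definition ratio u d (i : 'I_3) : rat := (u i)%:~R / (d i)%:~R.

(** [a - lam * b] up to a positive factor that makes it an integer. *)
Definition weight lam (a b : int) : int := denq lam * a - numq lam * b.

Lemma weight_gt0 lam (a b : int) :
  0 < b -> (0 < weight lam a b) = (lam < a%:~R / b%:~R).
Proof.
move=> b0; rewrite subr_gt0 ltr_pdivlMr ?ltr0z // -[in RHS](divq_num_den lam).
by rewrite mulrAC ltr_pdivrMr ?ltr0z // -!rmorphM /= ltr_int [a * _]mulrC.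
Qed.

Lemma weight_lt0 lam (a b : int) :
  0 < b -> (weight lam a b < 0) = (a%:~R / b%:~R < lam).
Proof.
move=> b0; rewrite subr_lt0 ltr_pdivrMr ?ltr0z // -[in RHS](divq_num_den lam).
by rewrite mulrAC ltr_pdivlMr ?ltr0z // -!rmorphM /= ltr_int [a * _]mulrC.
Qed.

Definition mutate_tropical u d k : 'I_3 -> int :=
  update u k (Num.min (d (k - 1) * u (k + 1)) (d (k + 1) * u (k - 1)) - u k).

Lemma update_id (x : 'I_3 -> int) k y : update x k y k = y.
Proof. by rewrite /update eqxx. Qed.

Lemma update_ne (x : 'I_3 -> int) k y i : i != k -> update x k y i = x i.
Proof. by rewrite /update => /negPf ->. Qed.

Lemma ratio_mutate_ne u d k i :
  i != k -> ratio (mutate_tropical u d k) (mutate_degree d k) i = ratio u d i.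
Proof. by move=> ik; rewrite /ratio /mutate_tropical /mutate_degree !update_ne. Qed.

(** The minimum of the two neighbouring ratios is the average of the old and the
    new ratio at [k] with weights the old and the new degree. *)
Lemma ratio_mutate u d k :
  (forall i, 0 < d i) -> 0 < mutate_degree d k k ->
  (mutate_degree d k k)%:~R *
    (Num.min (ratio u d (k + 1)) (ratio u d (k - 1))
       - ratio (mutate_tropical u d k) (mutate_degree d k) k)
  = (d k)%:~R * (ratio u d k - Num.min (ratio u d (k + 1)) (ratio u d (k - 1))).
Proof.
move=> d0 d'0.
have nz i : (d i)%:~R != 0 :> rat by rewrite intr_eq0 gt_eqF.
have nz' : (mutate_degree d k k)%:~R != 0 :> rat by rewrite intr_eq0 gt_eqF.
set mn := Num.min _ _.
have E : (d (k + 1) * d (k - 1))%:~R * mn =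
    (Num.min (d (k - 1) * u (k + 1)) (d (k + 1) * u (k - 1)))%:~R.
  rewrite minr_pMr ?ler0z ?mulr_ge0 1?ltW //.
  have -> : (d (k + 1) * d (k - 1))%:~R * ratio u d (k + 1) =
      (d (k - 1) * u (k + 1))%:~R.
    by rewrite /ratio !rmorphM /=; field; rewrite nz.
  have -> : (d (k + 1) * d (k - 1))%:~R * ratio u d (k - 1) =
      (d (k + 1) * u (k - 1))%:~R.
    by rewrite /ratio !rmorphM /=; field; rewrite nz.
  by rewrite !minEle ler_int; case: ifP.
rewrite !mulrBr /ratio [X in _ - X]mulrC divfK //.
rewrite [(d k)%:~R * (_ / _)]mulrC divfK // /mutate_tropical /mutate_degree.
rewrite !update_id !rmorphB /= -E.
by rewrite rmorphM /=; ring.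
Qed.

Lemma ratio_mutate_lt u d k :
  (forall i, 0 < d i) -> 0 < mutate_degree d k k ->
  Num.min (ratio u d (k + 1)) (ratio u d (k - 1)) < ratio u d k ->
  ratio (mutate_tropical u d k) (mutate_degree d k) k
    < Num.min (ratio u d (k + 1)) (ratio u d (k - 1)).
Proof.
move=> d0 d'0 lt; rewrite -subr_gt0.
have d'r : 0 < (mutate_degree d k k)%:~R :> rat by rewrite ltr0z.
by rewrite -(pmulr_rgt0 _ d'r) ratio_mutate // mulr_gt0 ?ltr0z // subr_gt0.
Qed.

Definition nonconstant (r : 'I_3 -> rat) := ~ exists c, forall i, r i = c.

Lemma nonconstant_gt_min (r : 'I_3 -> rat) :
  nonconstant r -> exists k, Num.min (r (k + 1)) (r (k - 1)) < r k.
Proof.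
move=> nc; apply: contrapT => no; apply: nc; exists (r 0).
have le k l : r k <= r l.
  have : r k <= Num.min (r (k + 1)) (r (k - 1)).
    by rewrite leNgt; apply/negP => ?; apply: no; exists k.
  by rewrite le_min => /andP[? ?]; case: (I3_cases k l) => ->.
by move=> i; apply: le_anti; rewrite !le.
Qed.

(** If the new ratios are all equal, then so are the old ones, by the averaging
    identity. *)
Lemma nonconstant_mutate u d k :
  (forall i, 0 < d i) -> 0 < mutate_degree d k k ->
  nonconstant (ratio u d) ->
  nonconstant (ratio (mutate_tropical u d k) (mutate_degree d k)).
Proof.
move=> d0 d'0 nc [c r'c]; apply: nc; exists c => i.
have rp : ratio u d (k + 1) = c by rewrite -(@ratio_mutate_ne u d k) ?I3_neq.
have rm : ratio u d (k - 1) = c by rewrite -(@ratio_mutate_ne u d k) ?I3_neq.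
have := ratio_mutate u d0 d'0; rewrite r'c rp rm minxx subrr mulr0 => /esym/eqP.
rewrite mulf_eq0 intr_eq0 gt_eqF //= subr_eq0 => /eqP rk.
by case: (I3_cases k i) => ->.
Qed.

End Tropical.

(** * Cluster ratios and the origin of the spectrum *)

Section MutationCyclic.
Context {R : realType}.
Let K : fieldType := R[i].
Let F : fieldType := rational_functions K (3 + 0).
Let iota : K -> F := @ratfun_const K (3 + 0).
Context (s : seed F 3 0) (d0 u0 : 'I_3 -> int).

Let order lam : F -> int -> Prop :=
  @has_order R (3 + 0) (fun i => weight lam (u0 i) (d0 i)).
Let bdd lam : F -> Prop := @bounded R (3 + 0) (fun i => weight lam (u0 i) (d0 i)).
Let sml lam : F -> Prop := @small R (3 + 0) (fun i => weight lam (u0 i) (d0 i)).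

(** The exponents [u] are measured along the curves through the initial seed [s]
    with exponents [u0 - lam * d0], for all [lam] at once. *)
Definition tropical_seed (t : seed F 3 0) (d u : 'I_3 -> int) : Prop :=
  [/\ exists e, cyclic_seed t e d,
      forall lam i, order lam (cluster t 0 (lshift 0 i)) (weight lam (u i) (d i))
    & nonconstant (ratio u d)].

Hypothesis cyclic : forall t, seed_of s t ->
  skew_symmetric t /\ exists e d, cyclic_seed t e d.
Hypothesis tropical_s : tropical_seed s d0 u0.

Let A : set F := cluster_algebra iota s.

Lemma tropical_seed_mutate t d u k :
  seed_of s t -> tropical_seed t d u ->
  tropical_seed (mutate t k) (mutate_degree d k) (mutate_tropical u d k) /\
  0 < mutate_degree d k k.
Proof.
move=> st [[e cyc] ord nc]; have [skt _] := cyclic st.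
have [_ [e' [d' cyc']]] := cyclic (seed_of_mutate k st).
have [ee dd] := cyclic_seed_mutate skt cyc cyc'.
have {}dd : d' = mutate_degree d k by apply: funext.
subst d'; have [_ d'pos _] := cyc'; have [_ dpos _] := cyc.
split; last exact: d'pos.
split; [by exists e' | | exact: nonconstant_mutate].
move=> lam i; have [->|ik] := eqVneq i k; last first.
  rewrite /mutate_tropical /mutate_degree !update_ne // mxE.
  rewrite (inj_eq (@lshift_inj _ _)) (negPf ik).
  exact: ord.
rewrite (cyclic_seed_exchange k skt cyc) /mutate_tropical /mutate_degree !update_id.
(* [weight lam] is linear, so it commutes with the tropical exchange relation,
   the degrees being homogeneous of the same degree in both monomials. *)
have -> : weight lam
    (Num.min (d (k - 1) * u (k + 1)) (d (k + 1) * u (k - 1)) - u k)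
    (d (k + 1) * d (k - 1) - d k) =
  - weight lam (u k) (d k) +
  Num.min (d (k - 1) * weight lam (u (k + 1)) (d (k + 1)))
          (d (k + 1) * weight lam (u (k - 1)) (d (k - 1))).
  have den : 0 < denq lam by [].
  rewrite /weight minEle [in RHS]minEle.
  have -> : (d (k - 1) * (denq lam * u (k + 1) - numq lam * d (k + 1)) <=
             d (k + 1) * (denq lam * u (k - 1) - numq lam * d (k - 1))) =
            (d (k - 1) * u (k + 1) <= d (k + 1) * u (k - 1)).
    rewrite -[RHS](ler_pM2l den) -[RHS](lerD2r (- (numq lam * d (k + 1) * d (k - 1)))).
    by congr (_ <= _); ring.
  by case: ifP => _; ring.
apply: has_orderM; first by apply: has_orderV; exact: ord.
by apply: has_orderD; apply: has_orderX; rewrite ?ltW //; exact: ord.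
Qed.

Lemma tropical_seed_of t : seed_of s t -> exists d u, tropical_seed t d u.
Proof.
move=> [ks ->]; elim/last_ind: ks => [|ks k [d [u IHks]]]; first by exists d0, u0.
rewrite foldl_rcons; exists (mutate_degree d k), (mutate_tropical u d k).
by case: (tropical_seed_mutate k _ IHks) => //; exists ks.
Qed.

Definition cluster_ratio (r : rat) : Prop :=
  exists t d u i, [/\ seed_of s t, tropical_seed t d u & r = ratio u d i].

Lemma cluster_ratio_exists : exists r, cluster_ratio r.
Proof. by exists (ratio u0 d0 0), s, d0, u0, 0; split=> //; exists [::]. Qed.

(** A seed has a vertex whose ratio exceeds the minimum of the other two; mutating
    there produces a ratio below all three. *)
Lemma cluster_ratio_descent r :
  cluster_ratio r -> exists2 r', cluster_ratio r' & r' < r.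
Proof.
move=> [t [d [u [i [st tt ->]]]]].
have [[e [_ dpos _]] _ nc] := tt.
have [k min_lt] := nonconstant_gt_min nc.
have [tt' d'pos] := tropical_seed_mutate k st tt.
exists (ratio (mutate_tropical u d k) (mutate_degree d k) k).
  exists (mutate t k), (mutate_degree d k), (mutate_tropical u d k), k.
  by split=> //; exact: seed_of_mutate.
apply: lt_le_trans (ratio_mutate_lt dpos d'pos min_lt) _.
case: (I3_cases k i) => ->; first exact: ltW.
- by rewrite ge_min lexx.
- by rewrite ge_min lexx orbT.
Qed.

(** The bound has to be the ratio of a cluster variable: the descent then provides
    a cluster variable violating any property that holds below it. *)
Definition deep (Q : rat -> Prop) : Prop :=
  exists2 r, cluster_ratio r & forall lam, lam < r -> Q lam.

Lemma deep_mono (Q Q' : rat -> Prop) :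
  (forall lam, Q lam -> Q' lam) -> deep Q -> deep Q'.
Proof. by move=> QQ' [r cr rQ]; exists r => // lam /rQ/QQ'. Qed.

Lemma deep_and (Q Q' : rat -> Prop) :
  deep Q -> deep Q' -> deep (fun lam => Q lam /\ Q' lam).
Proof.
move=> [r cr rQ] [r' cr' rQ']; exists (Num.min r r').
  by rewrite minEle; case: ifP.
by move=> lam; rewrite lt_min => /andP[/rQ ? /rQ'].
Qed.

Lemma deep_true (Q : rat -> Prop) : (forall lam, Q lam) -> deep Q.
Proof. by have [r cr] := cluster_ratio_exists; exists r. Qed.

Lemma deep_exists (Q : rat -> Prop) : deep Q -> exists lam, Q lam.
Proof. by move=> [r _ rQ]; exists (r - 1); apply: rQ; rewrite gtrDl. Qed.

Lemma deep_all (T : eqType) (l : seq T) (Q : T -> rat -> Prop) :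
  (forall x, x \in l -> deep (Q x)) ->
  deep (fun lam => forall x, x \in l -> Q x lam).
Proof.
elim: l => [_|x l IHl dQ]; first exact: deep_true.
have dx := dQ x (mem_head _ _).
have dl : deep (fun lam => forall y, y \in l -> Q y lam).
  by apply: IHl => y yl; apply: dQ; rewrite inE yl orbT.
apply: deep_mono (deep_and dx dl) => lam [Qx Ql] y.
by rewrite inE => /predU1P[->|/Ql].
Qed.

Lemma bdd_of_sml lam x c : sml lam (x - iota c) -> bdd lam x.
Proof.
move=> /small_bounded sx; rewrite -(subrK (iota c) x).
exact: boundedD sx (bounded_const _ _).
Qed.

(** The scalar [c] is the constant term of [x] for the positive grading of [A] in
    which the cluster variables have their positive degrees. *)
Lemma cluster_algebra_value x :
  A x -> exists c, deep (fun lam => sml lam (x - iota c)).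
Proof.
elim=> {x} [c | x gx | x y _ [c dx] _ [c' dy] | x y _ [c dx] _ [c' dy]].
- exists c; apply: deep_true => lam; rewrite subrr; exact: small0.
- case: gx => [[t [st [i ->]]]|[[[]]|[[]]]] //.
  exists 0; have [d [u tt]] := tropical_seed_of st.
  exists (ratio u d i); first by exists t, d, u, i.
  move=> lam lt; have [[e [_ dpos _]] ord _] := tt.
  rewrite /iota ratfun_const0 subr0; apply: has_order_small (ord lam i).
  by rewrite weight_gt0.
- exists (c + c'); apply: deep_mono (deep_and dx dy) => lam [sx sy].
  have -> : x + y - iota (c + c') = (x - iota c) + (y - iota c').
    by rewrite /iota ratfun_constD; ring.
  exact: smallD.
- exists (c * c'); apply: deep_mono (deep_and dx dy) => lam [sx sy].
  have -> : x * y - iota (c * c') = x * (y - iota c') + iota c' * (x - iota c).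
    by rewrite /iota ratfun_constM; ring.
  by apply: smallD; apply: bounded_smallM => //;
    [exact: bdd_of_sml sx | exact: bounded_const].
Qed.

Let origin : set F := [set x | A x /\ deep (fun lam => sml lam x)].

(** A product with zero constant term has a factor with zero constant term, the
    scalars being a field. *)
Lemma origin_prime : prime_ideal A origin.
Proof.
have inA : subalg_gen iota (cluster_generators s) = A by [].
split=> [x [] // || x y [Ax dx] [Ay dy] | a x Aa [Ax dx] |].
- split; first by rewrite -(ratfun_const0 K (3 + 0)); exact: subalg_gen_scalar.
  by apply: deep_true => lam; exact: small0.
- split; first exact: subalg_gen_add.
  by apply: deep_mono (deep_and dx dy) => lam [sx sy]; exact: smallD.
- split; first exact: subalg_gen_mul.
  have [c da] := cluster_algebra_value Aa.
  apply: deep_mono (deep_and dx da) => lam [sx sa].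
  exact: bounded_smallM (bdd_of_sml sa) sx.
- have const0 c : deep (fun lam => sml lam (iota c)) -> c = 0.
    by move=> /deep_exists[lam]; exact: small_const_eq0.
  split=> [[_ d1] | x y Ax Ay [_ dxy]].
    have := const0 1; rewrite /iota ratfun_const1 => /(_ d1)/eqP.
    by rewrite oner_eq0.
  have [c dx] := cluster_algebra_value Ax.
  have [c' dy] := cluster_algebra_value Ay.
  have /eqP : c * c' = 0.
    apply: const0; apply: deep_mono (deep_and dxy (deep_and dx dy)).
    move=> lam [sxy [sx sy]].
    (* A combination of small elements with bounded coefficients. *)
    have -> : iota (c * c') = x * y +
        (x * (iota (-1) * (y - iota c')) + iota (- c') * (x - iota c)).
      have neg (a : K) : iota (- a) = - iota a.
        by apply/eqP; rewrite -addr_eq0 -ratfun_constD addNr ratfun_const0.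
      by rewrite !neg /iota ratfun_const1 ratfun_constM; ring.
    apply: smallD => //; apply: smallD; apply: bounded_smallM => //.
    + exact: bdd_of_sml sx.
    + by apply: bounded_smallM => //; exact: bounded_const.
    + exact: bounded_const.
  rewrite mulf_eq0 => /orP[] /eqP c0; [left | right]; split=> //.
    by apply: deep_mono dx => lam; rewrite c0 /iota ratfun_const0 subr0.
  by apply: deep_mono dy => lam; rewrite c0 /iota ratfun_const0 subr0.
Qed.

(** At the origin some [f] of the cover is invertible with [A_f] finitely
    generated, so all of [A] is bounded for small [lam], which the descent
    contradicts. *)
Lemma not_Spec_finite_type : ~ Spec_finite_type iota A.
Proof.
move=> [fs [fsA cover fg]].
have [f ffs nPf] := cover _ origin_prime.
have [Af f0] := fsA f ffs; have [gs gsE] := fg f ffs.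
have [c df] := cluster_algebra_value Af.
have c0 : c != 0.
  apply/eqP => c0; apply: nPf; split=> //.
  by apply: deep_mono df => lam; rewrite c0 /iota ratfun_const0 subr0.
have dfV : deep (fun lam => bdd lam f^-1).
  by apply: deep_mono df => lam; exact: bounded_inv.
have dgs : deep (fun lam => forall g, g \in gs -> bdd lam g).
  apply: deep_all => g ggs.
  have [a [e [Aa ->]]] : localization A f g by rewrite gsE; exact: subalg_gen_gen.
  have [c' da] := cluster_algebra_value Aa.
  apply: deep_mono (deep_and da dfV) => lam [sa bf].
  apply: boundedM; first exact: bdd_of_sml sa.
  rewrite -exprVn; elim: e => [|e IHe]; last by rewrite exprS; exact: boundedM.
  by rewrite expr0 -(ratfun_const1 K (3 + 0)); exact: bounded_const.
have [r cr rb] := dgs.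
have [lam clam lamr] := cluster_ratio_descent cr.
(* As [lam] is itself the ratio of a cluster variable, a second step yields a
   variable with a pole along the curve for [lam]. *)
have [_ [t [d [u [i [st tt ->]]]]] ltlam] := cluster_ratio_descent clam.
have [[e [_ dpos _]] ord _] := tt.
have : bdd lam (cluster t 0 (lshift 0 i)).
  set x := cluster _ _ _.
  have : localization A f x.
    exists x, 0%N; rewrite expr0 divr1; split=> //.
    by apply: subalg_gen_gen; left; exists t; split=> //; exists i.
  rewrite gsE; elim=> {x} [a | x xgs | x y _ bx _ by' | x y _ bx _ by'].
  - exact: bounded_const.
  - exact: rb xgs.
  - exact: boundedD.
  - exact: boundedM.
by apply: has_order_unbounded (ord lam i); rewrite weight_lt0.
Qed.

End MutationCyclic.

Lemma finitely_generated_Spec_finite_type (k F : fieldType) (iota : k -> F) (A : set F) :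
  A 1 -> finitely_generated iota A -> Spec_finite_type iota A.
Proof.
move=> A1 fgA; exists [:: 1]; split=> [f | P [_ _ _ _ [P1 _]] | f].
- by rewrite inE => /eqP->; rewrite oner_eq0.
- by exists 1; rewrite ?mem_head.
rewrite inE => /eqP->; suff -> : localization A 1 = A by [].
apply/seteqP; split=> [z [a [e [Aa ->]]] | z Az]; first by rewrite expr1n divr1.
by exists z, 0%N; rewrite expr0 divr1.
Qed.

Theorem proposition3p5 (R : realType) (B : 'M[int]_3) (hB : B^T = - B) :
  let s := initial_seed R[i] (col_mx B (0 : 'M[int]_(0, 3))) in
  let iota := @ratfun_const R[i] (3 + 0) in
  let A := cluster_algebra iota s in
  ~ Louise s ->
  ~ finitely_generated iota A /\ ~ Spec_variety iota A 3.
Proof.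
move=> s iota A nonLouise.
have sks : skew_symmetric s.
  move=> i j; rewrite !col_mxEu.
  by have /matrixP/(_ j i) := hB; rewrite !mxE.
have cyclic t : seed_of s t -> skew_symmetric t /\ exists e d, cyclic_seed t e d.
  move=> st; have skt := skew_symmetric_seed_of st sks; split=> //.
  have [[p path_p]|acyc] := pselect (exists p, bi_infinite_path (mutable_edge t) p).
    exact: bi_infinite_path_cyclic path_p.
  by case: nonLouise; apply: Louise_seed_of st (acyclic_Louise skt acyc).
have [_ [e [d cyc]]] := cyclic s (seed_of_refl s).
(* Any vector not proportional to the degrees would do. *)
pose u (i : 'I_3) : int := (i == 0)%:R.
have trop : tropical_seed d u s d u.
  have [_ dpos _] := cyc.
  split; first by exists e.
    move=> lam i; rewrite mxE.
    have E : lshift 0 i = i :> 'I_3 by exact: val_inj.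
    rewrite -[X in weight _ (u X) _]E -[X in weight _ _ (d X)]E.
    exact: (@has_order_var R 3 (fun i => weight lam (u i) (d i)) (lshift 0 i)).
  move=> [c rc]; have := rc 0; rewrite -(rc 1) /ratio /u /= mul0r mul1r.
  by move/eqP; rewrite invr_eq0 intr_eq0 gt_eqF.
have nft : ~ Spec_finite_type iota A := not_Spec_finite_type cyclic trop.
split=> [fg | [] //]; apply: nft; apply: finitely_generated_Spec_finite_type fg.
by rewrite -(ratfun_const1 _ (3 + 0)); exact: subalg_gen_scalar.
Qed.
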